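(* Let $D$ be a $4\times 4$ Euclidean distance matrix with embedding dimension $3$, with generating points $p^1,\ldots,p^4\in\mathbb{R}^3$ affinely spanning $\mathbb{R}^3$ and satisfying $\sum_{i=1}^4 p^i=\mathbf{0}$. Let $P$ be the $4\times 3$ matrix whose $i$-th row is $(p^i)^T$, let $B=PP^T$, let $b=\mathrm{diag}(B)\in\mathbb{R}^4$, and let $B^{\dagger}$ be the Moore-Penrose inverse of $B$. For $y\in\mathbb{R}^4$ set $\kappa_4(y)=e^T(y-b)-(y-b)^TB^{\dagger}(y-b)$. Then a given vector $d^m\in\mathbb{R}^4$ is self-consistent if and only if $\kappa_4(d^m)=0$, i.e., if and only if $$e^T(d^m-b)=(d^m-b)^TB^{\dagger}(d^m-b)=(d^m-b)^TP(P^TP)^{-2}P^T(d^m-b).$$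
   Context: An $n\times n$ matrix $D=(d_{ij})$ is a Euclidean distance matrix (EDM) if there are points $p^1,\ldots,p^n$ (generating points of $D$) in some Euclidean space with $d_{ij}=\|p^i-p^j\|^2$ for all $i,j$; the dimension of their affine span is the embedding dimension of $D$. For an $n\times n$ EDM $D$ with embedding dimension $r$, a vector $y\in\mathbb{R}^n$ is called self-consistent if the $(n+1)\times(n+1)$ matrix $\begin{bmatrix}0&y^T\\ y&D\end{bmatrix}$ is an EDM with embedding dimension $r$. Here $e$ is the all-ones vector and $\mathrm{diag}(B)$ is the vector of diagonal entries of $B$. *)

(* Defs.v *)
From HB Require Import structures.
From mathcomp Require Import all_boot all_order all_algebra.
From mathcomp Require Import reals.

Set Implicit Arguments.
Unset Strict Implicit.
Unset Printing Implicit Defensive.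

Import Order.TTheory GRing.Theory Num.Theory.
Local Open Scope ring_scope.

(* The norm `|_| on matrices in MathComp-Analysis is the sup norm, so the
   Euclidean norm is defined here. *)
Definition enorm (R : realType) (k : nat) (x : 'rV[R]_k) : R :=
  Num.sqrt (\sum_i x 0 i ^+ 2).

Definition generating_points (R : realType) (n k : nat)
    (D : 'M[R]_n) (p : 'I_n -> 'rV[R]_k) : Prop :=
  forall i j, D i j = enorm (p i - p j) ^+ 2.

Definition affine_span (R : realType) (n k : nat)
    (p : 'I_n -> 'rV[R]_k) (x : 'rV[R]_k) : Prop :=
  exists2 a : 'I_n -> R, \sum_i a i = 1 & x = \sum_i a i *: p i.

(* S is a translate x0 + V of an r-dimensional linear subspace V, the latter
   being given as the row space of a matrix. *)
Definition has_affine_dim (R : realType) (k : nat)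
    (S : 'rV[R]_k -> Prop) (r : nat) : Prop :=
  exists (x0 : 'rV[R]_k) (V : 'M[R]_k),
    \rank V = r /\ forall x, S x <-> (x - x0 <= V)%MS.

(* The dimension r does not depend on the choice of generating points, since
   these are unique up to isometry. *)
Definition is_EDM_of_dim (R : realType) (n : nat) (D : 'M[R]_n) (r : nat)
    : Prop :=
  exists (k : nat) (p : 'I_n -> 'rV[R]_k),
    generating_points D p /\ has_affine_dim (affine_span p) r.

Definition bordered (R : realType) (n : nat) (D : 'M[R]_n) (y : 'cV[R]_n)
    : 'M[R]_(1 + n) :=
  block_mx 0 y^T y D.

Definition self_consistent (R : realType) (n : nat)
    (D : 'M[R]_n) (y : 'cV[R]_n) : Prop :=
  exists r : nat, is_EDM_of_dim D r /\ is_EDM_of_dim (bordered D y) r.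

(* The four Penrose equations. *)
Definition penrose (R : realType) (m n : nat)
    (A : 'M[R]_(m, n)) (X : 'M[R]_(n, m)) : bool :=
  [&& A *m X *m A == A, X *m A *m X == X,
      (A *m X)^T == A *m X & (X *m A)^T == X *m A].

Lemma mulmx_tr_eq0 (R : realType) (m n : nat) (A : 'M[R]_(m, n)) :
  A *m A^T = 0 -> A = 0.
Proof.
move=> h; apply/matrixP => i j; rewrite mxE.
have := congr1 (fun M : 'M_m => M i i) h; rewrite !mxE => /eqP.
rewrite psumr_eq0; last by move=> l _; rewrite mxE -expr2 sqr_ge0.
by move=> /allP /(_ j (mem_index_enum j)); rewrite mxE -expr2 sqrf_eq0 => /eqP.
Qed.

Lemma row_free_gram_unit (R : realType) (m n : nat) (A : 'M[R]_(m, n)) :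
  row_free A -> A *m A^T \in unitmx.
Proof.
move=> fA; rewrite -row_free_unit -kermx_eq0; apply/eqP.
set K := kermx _; have K0 : K *m (A *m A^T) = 0 by exact: mulmx_ker.
have : K *m A = 0.
  by apply: mulmx_tr_eq0; rewrite trmx_mul mulmxA -(mulmxA K) K0 mul0mx.
by move/eqP; rewrite (mulmx_free_eq0 _ fA) => /eqP.
Qed.

(* Existence, from a rank factorization A = C *m F. *)
Lemma penrose_exists (R : realType) (m n : nat) (A : 'M[R]_(m, n)) :
  exists X, penrose A X.
Proof.
have [r [C [F [cC rF AE]]]] : exists r (C : 'M[R]_(m, r)) (F : 'M[R]_(r, n)),
    [/\ row_full C, row_free F & A = C *m F].
  exists (\rank A), (col_base A), (row_base A).
  by rewrite col_base_full row_base_free mulmx_base.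
have uF := row_free_gram_unit rF.
have uC : C^T *m C \in unitmx.
  by rewrite -{2}(trmxK C) row_free_gram_unit // /row_free mxrank_tr.
set G := invmx (F *m F^T); set H := invmx (C^T *m C).
have FG : F *m F^T *m G = 1%:M by exact: mulmxV.
have GF : G *m (F *m F^T) = 1%:M by exact: mulVmx.
have HC : H *m (C^T *m C) = 1%:M by exact: mulVmx.
exists (F^T *m G *m H *m C^T).
have sG : G^T = G by rewrite /G trmx_inv trmx_mul trmxK.
have sH : H^T = H by rewrite /H trmx_inv trmx_mul trmxK.
have AX : A *m (F^T *m G *m H *m C^T) = C *m H *m C^T.
  by rewrite AE !mulmxA -(mulmxA C F) -(mulmxA C (F *m _)) FG mulmx1.
have XA : F^T *m G *m H *m C^T *m A = F^T *m G *m F.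
  by rewrite AE !mulmxA -(mulmxA _ C^T C) -(mulmxA _ H) HC mulmx1.
rewrite /penrose AX XA; apply/and4P; split; apply/eqP.
- by rewrite AE !mulmxA -(mulmxA _ C^T C) -(mulmxA _ H) HC mulmx1.
- by rewrite !mulmxA -(mulmxA _ F F^T) -(mulmxA _ G (F *m _)) GF mulmx1.
- by rewrite !trmx_mul trmxK sH mulmxA.
- by rewrite !trmx_mul trmxK sG mulmxA.
Qed.

Lemma penrose_unique (R : realType) (m n : nat) (A : 'M[R]_(m, n))
    (X Y : 'M[R]_(n, m)) : penrose A X -> penrose A Y -> X = Y.
Proof.
case/and4P => /eqP x1 /eqP x2 /eqP x3 /eqP x4.
case/and4P => /eqP y1 /eqP y2 /eqP y3 /eqP y4.
have eA : A *m X = A *m Y.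
  rewrite -x3 -[in LHS]y1 -mulmxA trmx_mul x3 y3.
  by rewrite mulmxA x1.
have eB : X *m A = Y *m A.
  rewrite -x4 -[in LHS]y1 -[A *m Y *m A]mulmxA mulmxA trmx_mul x4 y4.
  by rewrite -mulmxA [A *m (X *m A)]mulmxA x1.
by rewrite -x2 eB -mulmxA eA mulmxA y2.
Qed.

Definition moore_penrose (R : realType) (m n : nat) (A : 'M[R]_(m, n))
    : 'M[R]_(n, m) :=
  xchoose (penrose_exists A).

Lemma moore_penroseP (R : realType) (m n : nat) (A : 'M[R]_(m, n)) :
  penrose A (moore_penrose A).
Proof. exact: xchooseP. Qed.

Definition ones (R : realType) (n : nat) : 'cV[R]_n := const_mx 1.

Definition diag_vec (R : realType) (n : nat) (B : 'M[R]_n) : 'cV[R]_n :=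
  \col_i B i i.

Definition kappa (R : realType) (n : nat) (B : 'M[R]_n) (y : 'cV[R]_n) : R :=
  let b := diag_vec B in
  ((ones R n)^T *m (y - b) - (y - b)^T *m moore_penrose B *m (y - b)) 0 0.

(* Main.v *)
Require Import Defs.
From HB Require Import structures.
From mathcomp Require Import all_boot all_order all_algebra.
From mathcomp Require Import reals.
From mathcomp Require Import ring.

Set Implicit Arguments.
Unset Strict Implicit.
Unset Printing Implicit Defensive.

Import Order.TTheory GRing.Theory Num.Theory.
Local Open Scope ring_scope.

(* If y is the vector of squared distances from a point q to the p^i, then
   y - b = |q|^2 e - 2 P q^T, so that e^T(y - b) and (y - b)^T B^+ (y - b) are
   both equal to 4 |q|^2.  Conversely the columns of P and e span R^4, so
   y - b = c e - 2 P q^T for some c and q, and kappa_4(y) = 0 says c = |q|^2,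
   which means that y consists of the squared distances from q.
   It remains to see that y is self-consistent iff it comes from such a q in the
   affine span of the p^i.  Gram matrices of differences to a base point are
   determined by D, hence so is the embedding dimension; equality of the
   dimensions forces the additional point to be an affine combination of the
   others, and the same combination of the p^i is then the required q. *)

(** * Euclidean norm and inner products *)

Lemma enorm_sqr (R : realType) (k : nat) (x : 'rV[R]_k) :
  enorm x ^+ 2 = (x *m x^T) 0 0.
Proof.
rewrite /enorm sqr_sqrtr; last by apply: sumr_ge0 => i _; exact: sqr_ge0.
by rewrite mxE; apply: eq_bigr => i _; rewrite mxE expr2.
Qed.

Lemma enorm_distC (R : realType) (k : nat) (x y : 'rV[R]_k) :
  enorm (x - y) = enorm (y - x).
Proof.
by rewrite /enorm; congr Num.sqrt; apply: eq_bigr => i _; rewrite !mxE -sqrrN opprB.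
Qed.

Lemma enorm0 (R : realType) (k : nat) : enorm (0 : 'rV[R]_k) = 0.
Proof. by rewrite /enorm big1 ?sqrtr0 // => i _; rewrite mxE expr0n. Qed.

Lemma enorm_sqrB (R : realType) (k : nat) (x y : 'rV[R]_k) :
  enorm (x - y) ^+ 2 = enorm x ^+ 2 + enorm y ^+ 2 - (x *m y^T) 0 0 *+ 2.
Proof.
have yx : (y *m x^T) 0 0 = (x *m y^T) 0 0.
  by rewrite -[y in LHS]trmxK -trmx_mul mxE.
rewrite !enorm_sqr linearB /= mulmxBl !mulmxBr !mxE.
move: yx; rewrite !mxE => ->; ring.
Qed.

(** * Gram matrices and affine dimension *)

Lemma mulmx_trE (R : realType) (m n k : nat) (A : 'M[R]_(m, k))
    (B : 'M[R]_(n, k)) i j :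
  (A *m B^T) i j = (row i A *m (row j B)^T) 0 0.
Proof. by rewrite !mxE; apply: eq_bigr => l _; rewrite !mxE. Qed.

(** If [x *m A *m A^T = 0] then [x *m A] has zero Gram matrix and so vanishes; thus both kernels
    agree. *)
Lemma mxrank_gram (R : realType) (m n : nat) (A : 'M[R]_(m, n)) :
  \rank (A *m A^T) = \rank A.
Proof.
apply/eqP; rewrite eqn_leq mxrankM_maxl /=.
have /mxrankS : (kermx (A *m A^T) <= kermx A)%MS.
  apply/sub_kermxP/mulmx_tr_eq0; rewrite trmx_mul mulmxA -(mulmxA _ A).
  by rewrite mulmx_ker mul0mx.
by rewrite !mxrank_ker leq_sub2lE ?rank_leq_row.
Qed.

(** Its row space is the direction space of the affine span, which turns affine dimension into a
    matrix rank. *)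
Definition diffs (R : realType) (n k : nat) (p : 'I_n -> 'rV[R]_k) (i0 : 'I_n)
    : 'M[R]_(n, k) :=
  \matrix_i (p i - p i0).

Lemma diffs_sub (R : realType) (n k : nat) (p : 'I_n -> 'rV[R]_k)
    (i0 i : 'I_n) : (p i - p i0 <= diffs p i0)%MS.
Proof. by rewrite -[_ - _](rowK (fun j => p j - p i0)) row_sub. Qed.

Lemma affine_spanP (R : realType) (n k : nat) (p : 'I_n -> 'rV[R]_k)
    (i0 : 'I_n) (x : 'rV[R]_k) :
  affine_span p x <-> (x - p i0 <= diffs p i0)%MS.
Proof.
split=> [[a a1 ->]|/submxP[w wE]].
  rewrite -[p i0 in X in (X <= _)%MS]scale1r -a1 scaler_suml -sumrB.
  by apply: summx_sub => i _; rewrite -scalerBr scalemx_sub // diffs_sub.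
have xE : x = p i0 + \sum_i w 0 i *: (p i - p i0).
  rewrite -[LHS](subrK (p i0)) addrC wE mulmx_sum_row; congr (_ + _).
  by apply: eq_bigr => i _; rewrite rowK.
pose s := \sum_j w 0 j.
(* The coefficients [w] sum to [s]; the missing weight [1 - s] goes to the base point. *)
exists (fun i => w 0 i + (if i == i0 then 1 - s else 0)).
  by rewrite big_split /= -big_mkcond big_pred1_eq addrC subrK.
under eq_bigr do rewrite scalerDl.
rewrite big_split /= (bigD1 i0 (P := xpredT) (F := fun i => (if _ then _ else _) *: _)) //=.
rewrite eqxx [X in _ + (_ + X)]big1 => [|i /negPf->]; last by rewrite scale0r.
rewrite addr0 scalerBl scale1r scaler_suml xE addrCA -sumrB; congr (_ + _).
by apply: eq_bigr => i _; rewrite scalerBr.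
Qed.

Lemma has_affine_dimP (R : realType) (n k : nat) (p : 'I_n -> 'rV[R]_k)
    (i0 : 'I_n) (r : nat) :
  has_affine_dim (affine_span p) r <-> \rank (diffs p i0) = r.
Proof.
split=> [[x0 [V [<- VE]]]|<-]; last first.
  exists (p i0), <<diffs p i0>>%MS; rewrite mxrank_gen; split=> // x.
  by rewrite genmxE; exact: affine_spanP.
have VD x : (x - x0 <= V)%MS <-> (x - p i0 <= diffs p i0)%MS.
  by split=> h; [apply/affine_spanP/VE | apply/VE/(affine_spanP _ i0)].
have p0V : (p i0 - x0 <= V)%MS by apply/VD; rewrite subrr sub0mx.
(* As [p i0 - x0] lies in [V], moving the base point from [x0] to [p i0] keeps the direction
   space. *)
have shiftE (v : 'rV[R]_k) : (v <= V)%MS <-> (v <= diffs p i0)%MS.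
  have := VD (p i0 + v); rewrite [p i0 + v - p i0]addrAC subrr add0r => <-.
  rewrite addrAC; split=> h; first exact: addmx_sub.
  by rewrite -[v](addKr (p i0 - x0)) addmx_sub // eqmx_opp.
apply/eqP; rewrite eqn_leq !mxrankS //; apply/row_subP => i; apply/shiftE; exact: row_sub.
Qed.

(** Polarization. The right-hand side involves [D] alone, so all generating configurations share
    this Gram matrix. *)
Lemma gram_diffs (R : realType) (n k : nat) (D : 'M[R]_n)
    (p : 'I_n -> 'rV[R]_k) (i0 : 'I_n) :
  generating_points D p ->
  diffs p i0 *m (diffs p i0)^T =
    \matrix_(i, j) ((D i i0 + D j i0 - D i j) / 2).
Proof.
move=> hp; apply/matrixP => i j; rewrite mulmx_trE !rowK mxE !hp.
rewrite -(subrKA (p i0) (p i) (- p j)) -(opprB (p j)) (enorm_sqrB (p i - p i0)).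
by field.
Qed.

(** Distances from [q] depend only on [w] and the Gram matrix, so they carry over between
    configurations with the same [D]. *)
Lemma enorm_diffs (R : realType) (n k : nat) (p : 'I_n -> 'rV[R]_k)
    (i0 i : 'I_n) (q : 'rV[R]_k) (w : 'rV[R]_n) :
  q - p i0 = w *m diffs p i0 ->
  enorm (q - p i) ^+ 2 =
    ((w - delta_mx 0 i) *m (diffs p i0 *m (diffs p i0)^T)
      *m (w - delta_mx 0 i)^T) 0 0.
Proof.
move=> qE; rewrite enorm_sqr -!mulmxA mulmxA -trmx_mul.
suff -> : q - p i = (w - delta_mx 0 i) *m diffs p i0 by [].
by rewrite mulmxBl -rowE rowK -qE opprB subrKA.
Qed.

(** * Self-consistency as existence of an additional point *)

Lemma generating_points_bordered (R : realType) (n k : nat) (D : 'M[R]_n)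
    (y : 'cV[R]_n) (z : 'I_(1 + n) -> 'rV[R]_k) :
  generating_points (bordered D y) z <->
  generating_points D (fun i => z (rshift 1 i)) /\
  forall i, y i 0 = enorm (z (lshift n 0) - z (rshift 1 i)) ^+ 2.
Proof.
split=> [hz|[hD hy] i j].
  split=> [i j|i]; first by rewrite -hz /bordered block_mxEdr.
  by rewrite -hz /bordered block_mxEur mxE.
rewrite /bordered -(splitK i) -(splitK j).
case: (split i) (split j) => [i'|i'] [j'|j'] /=.
- by rewrite block_mxEul !ord1 subrr enorm0 mxE expr0n.
- by rewrite block_mxEur ord1 mxE hy.
- by rewrite block_mxEdl ord1 hy enorm_distC.
- by rewrite block_mxEdr hD.
Qed.

Lemma self_consistentP (R : realType) (n k : nat) (D : 'M[R]_n.+1)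
    (p : 'I_n.+1 -> 'rV[R]_k) (y : 'cV[R]_n.+1) :
  generating_points D p ->
  self_consistent D y <->
  exists2 q, affine_span p q & forall i, y i 0 = enorm (q - p i) ^+ 2.
Proof.
move=> hp; pose X := diffs p ord0.
have rkE k' (z : 'I_n.+1 -> 'rV[R]_k') :
    generating_points D z -> \rank (diffs z ord0) = \rank X.
  by move=> hz; rewrite -mxrank_gram (gram_diffs _ hz) -(gram_diffs _ hp) mxrank_gram.
split.
  case=> r [[k1 [p' [/rkE rkp' /(has_affine_dimP _ ord0)]]]]; rewrite rkp' => <-.
  case=> k2 [z [/generating_points_bordered[hz hy] /(has_affine_dimP _ (rshift 1 ord0)) rz]].
  pose Z := diffs (fun i => z (rshift 1 i)) ord0.
  have ZM : (Z <= diffs z (rshift 1 ord0))%MS.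
    by apply/row_subP => i; rewrite rowK diffs_sub.
  (* Both row spaces have the rank of [X], so the inclusion [ZM] is an equality. *)
  have MZ : (diffs z (rshift 1 ord0) <= Z)%MS.
    by rewrite -(mxrank_leqif_sup ZM) rz (rkE _ _ hz).
  have /submxP[w wE] : (z (lshift n.+1 0) - z (rshift 1 ord0) <= Z)%MS.
    exact: submx_trans (diffs_sub _ _ _) MZ.
  (* The coefficients of the new point relative to [z] are reused relative to [p]. *)
  exists (p ord0 + w *m X) => [|i].
    by apply/(affine_spanP _ ord0); rewrite addrAC subrr add0r submxMl.
  rewrite hy (enorm_diffs i wE) (gram_diffs _ hz) -(gram_diffs ord0 hp).
  by rewrite -(@enorm_diffs _ _ _ _ _ _ (p ord0 + w *m X)) // addrAC subrr add0r.
case=> q /(affine_spanP _ ord0) qX hy; exists (\rank X); split.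
  by exists k, p; split=> //; apply/(has_affine_dimP _ ord0).
pose z (i : 'I_(1 + n.+1)) := if split i is inr j then p j else q.
have zl i : z (lshift n.+1 i) = q by rewrite /z (unsplitK (inl i)).
have zr i : z (rshift 1 i) = p i by rewrite /z (unsplitK (inr i)).
exists k, z; split.
  apply/generating_points_bordered; split=> [i j|i]; first by rewrite !zr hp.
  by rewrite zl zr hy.
apply/(has_affine_dimP _ (rshift 1 ord0)).
apply/eqP; rewrite eqn_leq !mxrankS //; apply/row_subP => i; rewrite rowK.
  by rewrite -[p i]zr -(zr ord0) diffs_sub.
(* The row of the new point is [q - p ord0], covered by [qX]. *)
rewrite -(splitK i); case: (split i) => j /=; rewrite zr ?zl // zr.
exact: diffs_sub.
Qed.

(** * The Moore-Penrose inverse and kappa *)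

Lemma row_full_gram_unit (R : realType) (m n : nat) (P : 'M[R]_(m, n)) :
  row_full P -> P^T *m P \in unitmx.
Proof.
by move=> fP; rewrite -{2}(trmxK P) row_free_gram_unit // /row_free mxrank_tr.
Qed.

(** Multiplying the candidate by [P *m P^T] on either side gives the orthogonal projection onto the
    column space of [P]; the Penrose equations follow, and uniqueness concludes. *)
Lemma moore_penrose_gram (R : realType) (m n : nat) (P : 'M[R]_(m, n)) :
  row_full P ->
  moore_penrose (P *m P^T) =
    P *m (invmx (P^T *m P) *m invmx (P^T *m P)) *m P^T.
Proof.
move=> /row_full_gram_unit uG; apply: penrose_unique (moore_penroseP _) _.
set G := P^T *m P in uG *.
have sG : (invmx G)^T = invmx G by rewrite trmx_inv trmx_mul trmxK.
have BX : P *m P^T *m (P *m (invmx G *m invmx G) *m P^T) = P *m invmx G *m P^T.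
  by rewrite !mulmxA -(mulmxA P P^T) -/G -(mulmxA P G) mulmxV // mulmx1.
have XB : P *m (invmx G *m invmx G) *m P^T *m (P *m P^T) = P *m invmx G *m P^T.
  by rewrite !mulmxA -(mulmxA _ P^T P) -/G -(mulmxA _ _ G) mulVmx // mulmx1.
rewrite /penrose BX XB; apply/and4P; split; apply/eqP.
- by rewrite !mulmxA -(mulmxA _ P^T P) -/G -(mulmxA _ _ G) mulVmx // mulmx1.
- by rewrite !mulmxA -(mulmxA _ P^T P) -/G -(mulmxA _ _ G) mulVmx // mulmx1.
- by rewrite !trmx_mul trmxK sG mulmxA.
- by rewrite !trmx_mul trmxK sG mulmxA.
Qed.

Lemma ones_decomp (R : realType) (n : nat) (P : 'M[R]_(n.+1, n))
    (u : 'cV[R]_n.+1) :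
  row_full P -> (ones R n.+1)^T *m P = 0 ->
  exists (c : R) (q : 'rV[R]_n), u = c *: ones R n.+1 - (P *m q^T) *+ 2.
Proof.
move=> fP eP; pose e := ones R n.+1.
have ee : e^T *m e = n.+1%:R%:M.
  apply/matrixP => i j; rewrite !ord1 !mxE eqxx.
  under eq_bigr do rewrite !mxE mulr1.
  by rewrite sumr_const card_ord.
have Pe : P^T *m e = 0 by rewrite -[LHS]trmxK trmx_mul trmxK eP trmx0.
pose W : 'M_(1 + n) := row_mx e P.
have uW : W \in unitmx.
  (* Since [e] is orthogonal to the columns of [P], this Gram matrix is block diagonal with blocks
     [n.+1] and [P^T *m P]. *)
  have : W^T *m W \in unitmx.
    rewrite tr_row_mx mul_col_row ee eP Pe unitmxE det_ublock unitrM -!unitmxE.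
    by rewrite row_full_gram_unit // unitmxE det_scalar1 unitfE pnatr_eq0.
  by rewrite unitmx_mul => /andP[].
have uE : u = W *m (invmx W *m u) by rewrite mulKVmx.
move: (invmx W *m u) uE => v; rewrite -[v]vsubmxK mul_row_col => ->.
(* The factor [- 2^-1] cancels the [- 2] in the required form. *)
exists (usubmx v 0 0), (- 2^-1 *: (dsubmx v)^T); congr (_ + _).
  by rewrite {1}[usubmx v]mx11_scalar mul_mx_scalar.
rewrite linearZ /= trmxK -scalemxAr -scaler_nat scalerA.
by rewrite mulrN mulfV ?pnatr_eq0 // scaleN1r opprK.
Qed.

(** The linear term is [4 * c] because [e^T e = 4] and [e^T P = 0]; the quadratic term is
    [4 * enorm q ^+ 2] because [P^T u = - 2 G q^T]. *)
Lemma kappa_decomp (R : realType) (P : 'M[R]_(4, 3)) (y : 'cV[R]_4) (c : R)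
    (q : 'rV[R]_3) :
  row_full P -> (ones R 4)^T *m P = 0 ->
  y - diag_vec (P *m P^T) = c *: ones R 4 - (P *m q^T) *+ 2 ->
  kappa (P *m P^T) y = 4 * (c - enorm q ^+ 2).
Proof.
move=> fP eP yE; rewrite /kappa yE moore_penrose_gram //.
have uG := row_full_gram_unit fP; set G := P^T *m P in uG *.
have Pe : P^T *m ones R 4 = 0 by rewrite -[LHS]trmxK trmx_mul trmxK eP trmx0.
set u := c *: ones R 4 - _.
have Pu : P^T *m u = - 2 *: (G *m q^T).
  by rewrite mulmxBr -scalemxAr Pe scaler0 sub0r -scaler_nat -scalemxAr mulmxA scaleNr.
have GPu : invmx G *m (P^T *m u) = - 2 *: q^T.
  by rewrite Pu -scalemxAr mulKmx.
have uGP : u^T *m P *m invmx G = - 2 *: q.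
  have sG : (invmx G)^T = invmx G by rewrite trmx_inv trmx_mul trmxK.
  transitivity (invmx G *m (P^T *m u))^T; last by rewrite GPu linearZ /= trmxK.
  by rewrite !trmx_mul trmxK sG.
have -> : u^T *m (P *m (invmx G *m invmx G) *m P^T) *m u = 4 *: (q *m q^T).
  rewrite !mulmxA uGP -!mulmxA GPu -scalemxAl -scalemxAr scalerA; congr (_ *: _).
  by ring.
have -> : (ones R 4)^T *m u = (4 * c)%:M.
  rewrite mulmxBr -scaler_nat -!scalemxAr mulmxA eP mul0mx scaler0 subr0.
  apply/matrixP => i j; rewrite !ord1 !mxE eqxx !big_ord_recl big_ord0 !mxE.
  by rewrite mulr1n; ring.
by rewrite !mxE eqxx mulr1n enorm_sqr mxE mulrBr.
Qed.

Lemma diag_vec_decompP (R : realType) (n k : nat) (P : 'M[R]_(n, k))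
    (y : 'cV[R]_n) (q : 'rV[R]_k) :
  (forall i, y i 0 = enorm (q - row i P) ^+ 2) <->
  y - diag_vec (P *m P^T) = enorm q ^+ 2 *: ones R n - (P *m q^T) *+ 2.
Proof.
have E i : enorm (q - row i P) ^+ 2 =
    (diag_vec (P *m P^T) + (enorm q ^+ 2 *: ones R n - (P *m q^T) *+ 2)) i 0.
  rewrite enorm_distC enorm_sqrB [enorm (row i P) ^+ 2]enorm_sqr -mulmx_trE.
  by have := mulmx_trE P q i 0; rewrite row_id => <-; rewrite !mxE; ring.
split=> [h|/(canRL (subrK _)) -> i]; last by rewrite E addrC.
by apply/(canLR (addrK _))/colP => i; rewrite h E addrC.
Qed.

Theorem proposition3p1 (R : realType) (D : 'M[R]_4) (p : 'I_4 -> 'rV[R]_3)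
    (hD : is_EDM_of_dim D 3)
    (hgen : generating_points D p)
    (hspan : forall x : 'rV[R]_3, affine_span p x)
    (hcent : \sum_i p i = 0)
    (dm : 'cV[R]_4) :
  let P : 'M[R]_(4, 3) := \matrix_(i < 4) p i in
  let B : 'M[R]_4 := P *m P^T in
  let b : 'cV[R]_4 := diag_vec B in
  (self_consistent D dm <-> kappa B dm = 0) /\
  (self_consistent D dm <->
     (ones R 4)^T *m (dm - b) = (dm - b)^T *m moore_penrose B *m (dm - b) /\
     (dm - b)^T *m moore_penrose B *m (dm - b) =
       (dm - b)^T *m P *m (P^T *m P) ^- 2 *m P^T *m (dm - b)).
Proof.
move=> P B b.
have rowP i : row i P = p i by rewrite rowK.
have fP : row_full P.
  (* Each standard basis vector is an affine combination of the [p i], hence lies in the row space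
     of [P]. *)
  rewrite -sub1mx; apply/row_subP => j; have [a _ ->] := hspan (row j 1%:M).
  by apply: summx_sub => i _; rewrite scalemx_sub // -rowP row_sub.
have eP : (ones R 4)^T *m P = 0.
  by rewrite mulmx_sum_row -{2}hcent; apply: eq_bigr => i _; rewrite rowP !mxE scale1r.
have kappaP : self_consistent D dm <-> kappa B dm = 0.
  rewrite (self_consistentP _ hgen); split=> [[q _ hq]|].
    have /diag_vec_decompP h : forall i, dm i 0 = enorm (q - row i P) ^+ 2.
      by move=> i; rewrite rowP.
    by rewrite (kappa_decomp fP eP h) subrr mulr0.
  have [c [q h]] := ones_decomp (dm - b) fP eP.
  rewrite (kappa_decomp fP eP h) => /eqP.
  rewrite mulf_eq0 pnatr_eq0 /= subr_eq0 => /eqP cE; exists q => // i.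
  by rewrite -rowP; move: i; apply/diag_vec_decompP; rewrite -cE.
split=> //; rewrite kappaP /kappa -/b mxE [X in _ + X]mxE.
(* The closed form of the Moore-Penrose inverse makes the second equality an identity; the first is
   [kappa B dm = 0] as an equality of 1 by 1 matrices. *)
have -> : (dm - b)^T *m P *m (P^T *m P) ^- 2 *m P^T *m (dm - b) =
    (dm - b)^T *m moore_penrose B *m (dm - b).
  rewrite moore_penrose_gram // !mulmxA; do 2!congr (_ *m _).
  by rewrite -!mulmxA; congr (_ *m (_ *m _)); rewrite expr2 invrM ?row_full_gram_unit.
split=> [/eqP|[-> _]]; last by rewrite subrr.
rewrite subr_eq0 => /eqP h; split=> //.
by apply/matrixP => i j; rewrite !ord1.
Qed.
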